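(* Let $1\le m<\infty$ and let $\Lambda=\{\lambda_{\alpha}\}_{\alpha\in A_m}$ be a weight set for $A_m$ satisfying $( * )$ and $( ** )$. If $B$ is a shift invariant subset of $A_m$, then the submodule $\mathcal{M}_\Lambda(B)$ of $\mathcal{M}_\Lambda$ is essentially reductive.
   Context: $A_m$ is the set of multi-indices $\alpha=(\alpha_1,\dots,\alpha_m)$ of non-negative integers, $e_i$ is the multi-index with $1$ in position $i$ and $0$ elsewhere, and $Z^{\alpha}=z_1^{\alpha_1}\cdots z_m^{\alpha_m}$ in $\mathbb{C}[z]=\mathbb{C}[z_1,\dots,z_m]$. A weight set is a family $\Lambda=\{\lambda_\alpha\}_{\alpha\in A_m}$ with $0<\lambda_\alpha<\infty$. $\mathcal{M}_\Lambda$ is the Hilbert space completion of $\mathbb{C}[z]$ in which the monomials $\{Z^\alpha\}_{\alpha\in A_m}$ form an orthogonal set (with dense span) and $\|Z^\alpha\|=\lambda_\alpha$. $Z_i$ denotes the operator on $\mathcal{M}_\Lambda$ of multiplication by $z_i$, i.e. $Z_iZ^\alpha=Z^{\alpha+e_i}$. Condition $( * )$: $\lambda_\alpha\ge\lambda_{\alpha+e_i}$ for all $\alpha\in A_m$ and $1\le i\le m$ (so each $Z_i$ is a contraction and $\mathcal{M}_\Lambda$ is a Hilbert module over $\mathbb{C}[z]$, i.e. polynomials act by bounded operators). Condition $( ** )$: $[Z_i,Z_j^*]$ is compact for all $1\le i,j\le m$. A subset $B\subseteq A_m$ is shift invariant if $\alpha\in B$ implies $\alpha+e_i\in B$ for all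 $1\le i\le m$. $\mathcal{M}_\Lambda(B)$ is the closed subspace of $\mathcal{M}_\Lambda$ spanned by $\{Z^\alpha\}_{\alpha\in B}$; for $B$ shift invariant it is a submodule (closed subspace invariant under all $Z_i$). A Hilbert module over $\mathbb{C}[z]$ is essentially reductive if for every $\varphi\in\mathbb{C}[z]$ the operator $M_\varphi$ of module multiplication by $\varphi$ has compact self-commutator $M_\varphi^*M_\varphi-M_\varphi M_\varphi^*$. *)

(* Defs.v *)
From HB Require Import structures.
From mathcomp Require Import all_boot all_order all_algebra.
From mathcomp Require Import complex.
From mathcomp Require Import -(notations) mpoly.
From mathcomp Require Import all_classical all_reals all_analysis.
Import Order.TTheory GRing.Theory Num.Theory.
Import numFieldNormedType.Exports.

Set Implicit Arguments.
Unset Strict Implicit.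
Unset Printing Implicit Defensive.

Local Open Scope classical_set_scope.
Local Open Scope ring_scope.

Section MultiIndices.
Variables (R : realType) (m : nat).
Implicit Types lam : multinom m -> R.

Definition mshift (a : multinom m) (i : 'I_m) : multinom m :=
  mnm_add a (mnm1 i).

Definition weight_set lam := forall a, 0 < lam a.

Definition cond_star lam := forall a i, lam (mshift a i) <= lam a.

Definition shift_invariant (B : set (multinom m)) :=
  forall a, B a -> forall i, B (mshift a i).

End MultiIndices.

Section HilbertModules.
Variables (R : realType) (H : completeNormedModType R[i]).
Variable dot : {dot H for Num.conj}.

(* [dot] is linear in its first argument and conjugate-linear in its second;
   since [H] is complete, this makes [(H, dot)] a complex Hilbert space. *)
Definition hilbert_inner_product := forall x : H, `|x| ^+ 2 = dot x x.

Definition linear_span (S : set H) : set H :=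
  [set x | exists n (c : 'I_n -> R[i]) (v : 'I_n -> H),
             (forall k, S (v k)) /\ x = \sum_k c k *: v k].

Definition closed_span (S : set H) : set H := closure (linear_span S).

(* The operator notions below are relative to a closed subspace [V] of [H],
   regarded as a Hilbert space of its own: operators on [V] are represented by
   functions on [H] whose values outside [V] are irrelevant. An operator on the
   whole of [H] is the case [V = setT]. *)
Definition adjoint_on (V : set H) (T S : H -> H) :=
  (forall x, V x -> V (S x)) /\
  (forall x y, V x -> V y -> dot (T x) y = dot x (S y)).

Definition compact_on (V : set H) (T : H -> H) :=
  precompact (T @` [set x | V x /\ `|x| <= 1]).

Definition commutator (A B : H -> H) : H -> H := fun x => A (B x) - B (A x).

Variable m : nat.
Implicit Types Z : 'I_m -> {linear H -> H}.

(* Z_0^{a_0} Z_1^{a_1} ... Z_{m-1}^{a_{m-1}}; the order is immaterial for the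
   commuting tuples considered here. *)
Definition mact_monom Z (a : multinom m) : H -> H :=
  foldr (fun i f => iter (a i) (Z i) \o f) id (enum 'I_m).

(* Module multiplication by the polynomial [phi] on the module over C[z] in
   which z_i acts as [Z i]. *)
Definition mact Z (phi : mpoly m R[i]) : H -> H :=
  fun x => \sum_(a <- msupp phi) mcoeff a phi *: mact_monom Z a x.

Definition submodule Z (V : set H) :=
  [/\ closed V, V 0,
      forall (c : R[i]) x y, V x -> V y -> V (c *: x + y) &
      forall i x, V x -> V (Z i x)].

Definition essentially_reductive Z (V : set H) :=
  forall phi : mpoly m R[i], exists Mstar : H -> H,
    adjoint_on V (mact Z phi) Mstar /\
    compact_on V (commutator Mstar (mact Z phi)).

Definition cond_starstar Z :=
  forall i j : 'I_m, exists Zjstar : H -> H,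
    adjoint_on setT (Z j) Zjstar /\
    compact_on setT (commutator (Z i) Zjstar).

Variable lam : multinom m -> R.

(* [H] is a Hilbert space completion of C[z], embedded by [emb], in which the
   monomials are orthogonal and the monomial of exponent [a] has norm [lam a].
   Such a completion is unique up to a unitary fixing C[z]. *)
Definition weighted_completion (emb : {linear mpoly m R[i] -> H}) :=
  [/\ hilbert_inner_product,
      forall a b : multinom m,
        a <> b -> dot (emb (mpolyX _ a)) (emb (mpolyX _ b)) = 0,
      forall a : multinom m, `|emb (mpolyX _ a)| = (lam a)%:C%C &
      closed_span (range (fun a : multinom m => emb (mpolyX _ a))) = setT].

(* Each [Z i] is the bounded operator on [H] extending multiplication by z_i on
   C[z]; it is unique by density. *)
Definition coordinate_multipliers (emb : {linear mpoly m R[i] -> H}) Z :=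
  forall i, continuous (Z i) /\
            forall p, Z i (emb p) = emb (mpolyX _ (mnm1 i) * p).

Definition monomial_submodule (emb : {linear mpoly m R[i] -> H})
    (B : set (multinom m)) : set H :=
  closed_span [set emb (mpolyX _ a) | a in B].

End HilbertModules.

(* Main.v *)
Require Import Defs.
From HB Require Import structures.
From mathcomp Require Import all_boot all_order all_algebra.
From mathcomp Require Import complex.
From mathcomp Require Import -(notations) mpoly.
From mathcomp Require Import all_classical all_reals all_analysis.
Import Order.TTheory GRing.Theory Num.Theory.
Import numFieldNormedType.Exports.
Set Implicit Arguments.
Unset Strict Implicit.
Unset Printing Implicit Defensive.
Local Open Scope classical_set_scope.
Local Open Scope ring_scope.

(* Let P be the orthogonal projection onto M(B) and P' = 1 - P. The adjoint of
   z_j on M(B) is P Z_j^*, and on M(B)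
     [Z_i, P Z_j^*] = P [Z_i, Z_j^*] - (P Z_i P') Z_j^*,
   so everything reduces to the compactness of P Z_i P'; arbitrary polynomials
   then follow because the operators commuting with a given one modulo compacts
   form an algebra. By Dickson's lemma the monomials outside B that z_i maps
   into B have bounded exponent in z_i, so P Z_i P' = P Z_i Q_n P' with Q_n the
   projection onto the monomials of degree < n in z_i. Finally Z_i Q_n is
   compact by induction on n, because Z_i^* Z_i Q_(n+1) equals
   (Z_i Q_n) Z_i^* - [Z_i, Z_i^*] Q_(n+1), and T is compact when T^* T is. *)

(** * Total boundedness through finite colourings *)

Section TotallyBounded.
Variables (K : numFieldType) (U : Type) (W : completeNormedModType K).
Implicit Types (D : set U) (T : U -> W).

(** Total boundedness of the image, read on the domain: finitely many classes, on each of which [T]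
    oscillates by less than [e]. No centres have to be named, so sums are handled by product
    colourings and compositions by pulling colours back. *)
Definition finitely_colourable D T := forall e : K, 0 < e ->
  exists (C : finType) (f : U -> C),
    forall x y, D x -> D y -> f x = f y -> `|T x - T y| < e.

(** An ultrafilter containing the closure of the image is Cauchy, because finiteness of the colours
    forces it to contain a ball of each radius; completeness then gives its limit. *)
Lemma finitely_colourable_precompact D T :
  finitely_colourable D T -> precompact (T @` D).
Proof.
move=> Tfc; rewrite precompactE compact_ultra => F FF FA.
suff /cauchy_cvg Fc : cauchy F.
  exists (lim F); split=> //=.
  by apply: (closed_cvg (closure (T @` D)) (@closed_closure _ _)) FA _ Fc.
apply: cauchy_exP => e e0.
have e20 : 0 < e / 2 by rewrite divr_gt0.
have [C [f fT]] := Tfc _ e20.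
apply: contrapT => /forallNP noF.
(* If no ball of radius [e] is in [F], then each [far c] is: it contains the complement of the
   [e]-ball around any image of colour [c]. The finite intersection of these sets then meets the
   closure of the image, which is absurd. *)
pose far (c : C) : set W := [set z | forall x, D x -> f x = c ->
  ~ ball (T x) (e / 2) z].
have farF (c : C) : F (far c).
  have [[x [Dx fx]]|nox] := pselect (exists x, D x /\ f x = c); last first.
    by apply: filterS filterT => z _ x Dx fx; case: nox; exists x.
  have [/noF//|] := in_ultra_setVsetC (ball (T x) e) FF.
  apply: filterS => z zx y Dy fy zy; apply: zx.
  apply: ball_split zy.
  by rewrite -ball_normE /= distrC fT // fx fy.
have : F (fun z => forall c, far c z) by apply: filter_forall.
move=> /(filterI FA) /filter_ex[z [zA zfar]].
have /zA[_ [[x Dx <-]]] : nbhs z (ball z (e / 2)) by apply: nbhsx_ballx.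
by rewrite ball_symE; exact: zfar.
Qed.

Lemma precompact_finitely_colourable D T :
  precompact (T @` D) -> finitely_colourable D T.
Proof.
rewrite precompactE compact_cover => cA e e0.
have e20 : 0 < e / 2 by rewrite divr_gt0.
have [|x xA|I _ Icov] := cA W setT (fun z => ball z (e / 2)).
- by move=> z _; apply: ball_open.
- by exists x => //; apply: ballxx.
pose J := seq_sub (finmap.enum_fset I).
(* The colour of [x] is a centre of the finite subcover close to [T x]; [None] never occurs on
   [D]. *)
pose f x := [pick z : J | `|val z - T x| < e / 2].
exists (option J), f => x y Dx Dy.
have near_color z : D z -> exists2 c, f z = Some c & `|val c - T z| < e / 2.
  move=> Dz; rewrite /f; case: pickP => [c ?|none]; first by exists c.
  have /Icov[c cI] : closure (T @` D) (T z) by apply: subset_closure; exists z.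
  by rewrite -ball_normE /= => cz; have := none (SeqSub cI); rewrite /= cz.
have [[c -> cx] [d -> dy] [cd]] := (near_color x Dx, near_color y Dy).
rewrite -(subrKA (val c)) [ltRHS]splitr.
apply: le_lt_trans (ler_normD _ _) _.
by rewrite distrC ltrD // cd.
Qed.

End TotallyBounded.

(** * Dickson's lemma and shift invariant sets *)

(** Every tail of [f] attains its minimum. Successive minimisers over shrinking tails have
    nondecreasing values. *)
Lemma monotone_subsequence (f : nat -> nat) :
  exists2 s : nat -> nat, {homo s : m n / (m < n)%N} &
    {homo f \o s : m n / (m <= n)%N}.
Proof.
have argmin n : exists k, (n <= k)%N /\ forall l, (n <= l)%N -> (f k <= f l)%N.
  suff argmin_le : forall b k, (n <= k)%N -> (f k <= b)%N ->
      exists k, (n <= k)%N /\ forall l, (n <= l)%N -> (f k <= f l)%N.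
    exact: (argmin_le (f n) n).
  elim=> [|b IHb] k nk fkb.
    by exists k; split=> // l _; rewrite (leq_trans fkb).
  have [[l [nl fl]]|min_k] := pselect (exists l, (n <= l)%N /\ (f l < f k)%N).
    by apply: IHb nl _; rewrite -ltnS (leq_trans fl).
  exists k; split=> // l nl; rewrite leqNgt.
  by apply/negP => fl; case: min_k; exists l.
have [g gP] := choice argmin.
(* The next index minimises [f] strictly beyond the previous one, which makes [s] strictly
   increasing. *)
pose s := fix s n := if n is n'.+1 then g (s n').+1 else g 0%N.
have s_lt n : (s n < s n.+1)%N by have [] := gP (s n).+1.
have s_mono : {homo s : m n / (m < n)%N}.
  by apply: homo_ltn => //; apply: ltn_trans.
exists s => //; apply: homo_leq => //; first exact: leq_trans.
move=> n /=; case: n => [|n] /=.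
  by apply: (gP 0%N).2.
by apply: (gP (s n).+1).2; rewrite ltnW // (leq_ltn_trans (s_lt n)).
Qed.

(** Dickson's lemma in sequential form. Coordinates are treated one after the other; a further
    extraction preserves the monotonicity already obtained. *)
Lemma multinom_monotone_subsequence m (a : nat -> multinom m) :
  exists2 s : nat -> nat, {homo s : j k / (j < k)%N} &
    forall i, {homo (fun n => a (s n) i) : j k / (j <= k)%N}.
Proof.
suff [s s_mono sP] : exists2 s : nat -> nat, {homo s : j k / (j < k)%N} &
    forall i, i \in enum 'I_m -> {homo (fun n => a (s n) i) : j k / (j <= k)%N}.
  by exists s => // i; apply: sP; rewrite mem_enum.
elim: (enum 'I_m) => [|i r [s s_mono sP]]; first by exists id.
have [t t_mono tP] := monotone_subsequence (fun n => a (s n) i).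
exists (s \o t) => [j k jk|l]; first exact/s_mono/t_mono.
have t_le : {homo t : j k / (j <= k)%N} by apply: ltnW_homo.
rewrite inE => /predU1P[-> //|lr] j k jk /=.
exact/sP/t_le.
Qed.

Section ShiftInvariant.
Variables (m : nat) (B : set (multinom m)).
Hypothesis B_shift : shift_invariant B.

(** Induction on the degree of [b - a], removing one unit vector at a time. *)
Lemma shift_invariant_le (a b : multinom m) :
  B a -> (forall i, a i <= b i)%N -> B b.
Proof.
move=> Ba ab.
have -> : b = mnm_add a (mnm_sub b a).
  by rewrite addmC submK //; apply/mnm_lepP.
move: (mnm_sub b a) => {ab} c.
elim: {c}(mdeg c) {-2}c (erefl (mdeg c)) => [|n IHn] c.
  by move/eqP; rewrite mdeg_eq0 => /eqP->; rewrite addm0.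
move=> degc; have /existsP[i ci] : [exists i, c i != 0%N].
  rewrite -negb_forall; apply: contra_eqN degc => /forallP c0.
  by rewrite mdegE big1 // => i _; apply/eqP.
have ec : mnm_add (mnm_sub c (mnm1 i)) (mnm1 i) = c.
  apply/submK/mnm_lepP => j; rewrite mnm1E.
  by case: eqVneq => [<-|//]; rewrite lt0n.
rewrite -ec addmA; apply: B_shift; apply: IHn.
by apply: succn_inj; rewrite -degc -[in RHS]ec mdegD mdeg1 addn1.
Qed.

(** A sequence of counterexamples with unbounded [i]-th entry has a coordinatewise nondecreasing
    subsequence. A late enough term of it dominates the shift of the first term, hence lies in [B],
    a contradiction. *)
Lemma shift_entry_bound (i : 'I_m) :
  exists N, forall a : multinom m, ~ B a -> B (mshift a i) -> (a i < N)%N.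
Proof.
apply: contrapT => /forallNP unbounded.
have {unbounded} /choice[a aP] N :
    exists a : multinom m, [/\ ~ B a, B (mshift a i) & (N <= a i)%N].
  have /existsNP[a] := unbounded N.
  move=> /not_implyP[nBa] /not_implyP[Ba /negP]; rewrite -leqNgt => ?.
  by exists a.
have [s s_mono aI] := multinom_monotone_subsequence a.
have s_ge n : (n <= s n)%N.
  by elim: n => // n IHn; apply: leq_ltn_trans IHn (s_mono _ _ _).
(* The [i]-th entry of [a (s k)] is at least [s k], hence at least [k]: one more than that of the
   first term, which absorbs the shift. *)
pose k := (a (s 0%N) i).+1.
have [nBk _ _] := aP (s k); apply: nBk.
have [_ B0 _] := aP (s 0%N).
apply: shift_invariant_le B0 _ => j.
rewrite /mshift mnmDE mnm1E; case: eqVneq => [<-|_]; last first.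
  by rewrite addn0 aI.
by rewrite addn1 (leq_trans (s_ge k)) //; have [] := aP (s k).
Qed.

End ShiftInvariant.

(** * Bounded and compact operators *)

Section BoundedOperators.
Variables (K : numFieldType) (H : completeNormedModType K).
Implicit Types (T S : H -> H) (V : set H) (c : K) (x y : H).

(** A predicate on bare functions, since adjoints and projections come from existence statements
    without a bundled linear structure. The bound [M] is positive so that it can be inverted. *)
Definition bounded_operator T :=
  (forall c, {morph T : x y / c *: x + y}) /\
  exists2 M : K, 0 < M & forall x, `|T x| <= M * `|x|.

Lemma bounded_operator0 T : bounded_operator T -> T 0 = 0.
Proof. by case=> /(_ (-1) 0 0) + _; rewrite !scaleN1r !addNr. Qed.

Lemma bounded_operatorZ T c x : bounded_operator T -> T (c *: x) = c *: T x.
Proof.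
by move=> Tb; rewrite -[c *: x]addr0 Tb.1 (bounded_operator0 Tb) addr0.
Qed.

Lemma bounded_operatorB T x y : bounded_operator T -> T (x - y) = T x - T y.
Proof. by case=> /(_ (-1) y x) + _; rewrite !scaleN1r ![- _ + _]addrC. Qed.

Lemma bounded_operator_linear (f : {linear H -> H}) :
  continuous f -> bounded_operator f.
Proof.
move=> /linear_bounded_continuous/linear_boundedP/pinfty_ex_gt0[M M0 fM].
by split; [move=> c x y; rewrite linearP | exists M].
Qed.

Lemma bounded_operator_id : bounded_operator id.
Proof. by split=> //; exists 1 => // x; rewrite mul1r. Qed.

Lemma bounded_operator_cst0 : bounded_operator (fun=> 0).
Proof.
split=> [c x y|]; first by rewrite scaler0 addr0.
by exists 1 => // x; rewrite normr0 mul1r.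
Qed.

Lemma bounded_operator_comb c T S : bounded_operator T -> bounded_operator S ->
  bounded_operator (fun x => c *: T x + S x).
Proof.
move=> [Tl [M M0 TM]] [Sl [N N0 SN]]; split=> [d x y|].
  rewrite Tl Sl !scalerDr !scalerA [d * c]mulrC -!addrA; congr (_ + _).
  by rewrite !addrA; congr (_ + _); rewrite addrC.
exists (`|c| * M + N) => [|x]; first by rewrite ltr_wpDl // mulr_ge0 // ltW.
rewrite (le_trans (ler_normD _ _)) // mulrDl lerD //.
by rewrite normrZ -mulrA ler_wpM2l.
Qed.

Lemma bounded_operator_comp T S :
  bounded_operator T -> bounded_operator S -> bounded_operator (T \o S).
Proof.
move=> [Tl [M M0 TM]] [Sl [N N0 SN]]; split=> [d x y|].
  by rewrite /= Sl Tl.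
exists (M * N) => [|x /=]; first exact: mulr_gt0.
by rewrite (le_trans (TM _)) // -mulrA ler_wpM2l // ltW.
Qed.

Lemma bounded_operator_sub T S : bounded_operator T -> bounded_operator S ->
  bounded_operator (fun x => T x - S x).
Proof.
move=> Tb Sb; have := bounded_operator_comb (-1) Sb Tb.
by congr bounded_operator; apply/funext => x; rewrite scaleN1r addrC.
Qed.

Lemma bounded_operator_continuous T : bounded_operator T -> continuous T.
Proof.
move=> Tb x; have [_ [M M0 TM]] := Tb.
apply/cvgrPdist_lt => e e0; near=> z.
rewrite -bounded_operatorB // (le_lt_trans (TM _)) // -ltr_pdivlMl //.
by near: z; apply: cvgr_dist_lt => //; rewrite mulr_gt0 // invr_gt0.
Unshelve. all: by end_near. Qed.

Definition compact_operator V T :=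
  finitely_colourable [set x : H | V x /\ `|x| <= 1] T.

Lemma eq_compact_operator V T S :
  (forall x, V x -> T x = S x) -> compact_operator V S -> compact_operator V T.
Proof.
move=> TS cS e /cS[C [f fS]]; exists C, f => x y Vx Vy /(fS x y Vx Vy).
by rewrite (TS x Vx.1) (TS y Vy.1).
Qed.

Lemma sub_compact_operator V V' T :
  V `<=` V' -> compact_operator V' T -> compact_operator V T.
Proof.
move=> VV' cT e /cT[C [f fT]]; exists C, f => x y [Vx x1] [Vy y1].
by apply: fT; split=> //; apply: VV'.
Qed.

Lemma compact_operator_cst0 V : compact_operator V (fun=> 0).
Proof.
move=> e e0; exists unit, (fun=> tt) => x y _ _ _.
by rewrite subr0 normr0.
Qed.

Lemma compact_operator_add V T S : compact_operator V T ->
  compact_operator V S -> compact_operator V (fun x => T x + S x).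
Proof.
move=> cT cS e e0; have e20 : 0 < e / 2 by rewrite divr_gt0.
have [[C [f fT]] [D [g gS]]] := (cT _ e20, cS _ e20).
exists (C * D)%type, (fun x => (f x, g x)) => x y Vx Vy [fxy gxy].
rewrite opprD addrACA (le_lt_trans (ler_normD _ _)) // [ltRHS]splitr ltrD //.
  exact: fT.
exact: gS.
Qed.

Lemma compact_operator_compl V T S : bounded_operator S ->
  compact_operator V T -> compact_operator V (S \o T).
Proof.
move=> Sb cT e e0; have [_ [M M0 SM]] := Sb.
have [|C [f fT]] := cT (M^-1 * e); first by rewrite mulr_gt0 // invr_gt0.
exists C, f => x y Vx Vy /(fT x y Vx Vy) Txy /=.
by rewrite -bounded_operatorB // (le_lt_trans (SM _)) // -ltr_pdivlMl.
Qed.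

Lemma compact_operator_sub V T S : compact_operator V T ->
  compact_operator V S -> compact_operator V (fun x => T x - S x).
Proof.
move=> cT cS; apply: compact_operator_add cT _.
have Nb := bounded_operator_comb (-1) bounded_operator_id bounded_operator_cst0.
apply: eq_compact_operator (compact_operator_compl Nb cS) => x _.
by rewrite /= addr0 scaleN1r.
Qed.

(** With [M] a bound for [S], the map [M^-1 *: S] sends the unit ball of [V] into that of [V'], from
    which colours are pulled back. *)
Lemma compact_operator_compr V V' T S :
    (forall c x, V' x -> V' (c *: x)) -> bounded_operator T ->
    bounded_operator S -> (forall x, V x -> V' (S x)) ->
  compact_operator V' T -> compact_operator V (T \o S).
Proof.
move=> V'Z Tb Sb SV cT e e0; have [_ [M M0 SM]] := Sb.
have [|C [f fT]] := cT (M^-1 * e); first by rewrite mulr_gt0 // invr_gt0.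
have MS x : V x /\ `|x| <= 1 -> V' (M^-1 *: S x) /\ `|M^-1 *: S x| <= 1.
  move=> [Vx x1]; split; first exact/V'Z/SV.
  rewrite normrZ gtr0_norm ?invr_gt0 // ler_pdivrMl // mulr1.
  by rewrite (le_trans (SM _)) // ger_pMr.
exists C, (fun x => f (M^-1 *: S x)) => x y Vx Vy fxy /=.
have := fT _ _ (MS x Vx) (MS y Vy) fxy.
rewrite !(bounded_operatorZ _ _ Tb) -scalerBr normrZ gtr0_norm ?invr_gt0 //.
by rewrite ltr_pM2l ?invr_gt0.
Qed.

(** This abstracts the fact that [T] is compact when its composite with its adjoint is: for
    [S = T^* T], Cauchy-Schwarz gives the inequality with [M = 1]. *)
Lemma compact_operator_sqr_le V T S M : 0 < M ->
    bounded_operator T -> bounded_operator S ->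
    (forall x, `|T x| ^+ 2 <= M * `|S x| * `|x|) ->
  compact_operator V S -> compact_operator V T.
Proof.
move=> M0 Tb Sb TS cS e e0.
have M20 : 0 < M * 2 by rewrite mulr_gt0.
(* The factor 2 bounds the norm of [x - y] for [x] and [y] in the unit ball. *)
have [|C [f fS]] := cS ((M * 2)^-1 * e ^+ 2).
  by rewrite mulr_gt0 ?invr_gt0 // exprn_gt0.
exists C, f => x y Vx Vy /(fS x y Vx Vy) Sxy.
rewrite -(ltr_pXn2r (ltn0Sn 1)) ?nnegrE ?normr_ge0 ?(ltW e0) //.
rewrite -bounded_operatorB // (le_lt_trans (TS _)) //.
apply: (@le_lt_trans _ _ (M * 2 * `|S x - S y|)); last by rewrite -ltr_pdivlMl.
rewrite bounded_operatorB // mulrAC ler_wpM2r // ler_wpM2l ?(ltW M0) //.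
rewrite (le_trans (ler_normB _ _)) // [leRHS](natrD _ 1 1).
by rewrite lerD //; [case: Vx | case: Vy].
Qed.

End BoundedOperators.

(** * Commutation modulo compact operators *)

Section EssentialCommutation.
Variables (R : realType) (H : completeNormedModType R[i]) (V : set H).
Hypothesis V0 : V 0.
Hypothesis VP : forall (c : R[i]) x y, V x -> V y -> V (c *: x + y).
Implicit Types T S : H -> H.

Definition operator_on T := bounded_operator T /\ forall x, V x -> V (T x).

(** These closure properties are the ones that build [mact Z phi] from the [Z i], so such a
    predicate passes from the coordinates to all polynomials. *)
Definition operator_algebra (P : (H -> H) -> Prop) :=
  [/\ P id, P (fun=> 0),
      forall c T S, P T -> P S -> P (fun x => c *: T x + S x) &
      forall T S, P T -> P S -> P (T \o S)].

Lemma operator_algebra_on : operator_algebra operator_on.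
Proof.
split.
- by split=> //; apply: bounded_operator_id.
- by split=> //; apply: bounded_operator_cst0.
- move=> c T S [Tb TV] [Sb SV]; split; first exact: bounded_operator_comb.
  by move=> x Vx; apply: VP; [apply: TV|apply: SV].
- move=> T S [Tb TV] [Sb SV]; split; first exact: bounded_operator_comp.
  by move=> x Vx; apply/TV/SV.
Qed.

Definition essentially_commutes S T :=
  operator_on T /\ compact_operator V (commutator T S).

Lemma bounded_operator_commutator T S : bounded_operator T ->
  bounded_operator S -> bounded_operator (commutator T S).
Proof.
by move=> Tb Sb; apply: bounded_operator_sub; apply: bounded_operator_comp.
Qed.

Lemma essentially_commutes_sym T S : operator_on S ->
  essentially_commutes S T -> essentially_commutes T S.
Proof.
move=> So [_ cTS]; split=> //.
apply: eq_compact_operator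
  (compact_operator_sub (compact_operator_cst0 V) cTS) => x _.
by rewrite sub0r opprB.
Qed.

(** Commutation with [S] is a derivation: [T1 T2, S] = T1 [T2, S] + [T1, S] T2, and both terms are
    compact when the inner commutators are. *)
Lemma operator_algebra_commutant S :
  operator_on S -> operator_algebra (essentially_commutes S).
Proof.
move=> So; have [Sb SV] := So; have [Aid A0 Acomb Acomp] := operator_algebra_on.
split.
- split=> //; apply: eq_compact_operator (compact_operator_cst0 _) => x _.
  by rewrite /commutator subrr.
- split=> //; apply: eq_compact_operator (compact_operator_cst0 _) => x _.
  by rewrite /commutator (bounded_operator0 Sb) subr0.
- move=> c T1 T2 [T1o cT1] [T2o cT2]; split; first exact: Acomb.
  (* Scalar multiplication by [c], in the form [c *: x + 0]. *)
  have cZb := bounded_operator_comb c (bounded_operator_id H)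
    (bounded_operator_cst0 H).
  apply: eq_compact_operator
    (compact_operator_add (compact_operator_compl cZb cT1) cT2) => x _ /=.
  by rewrite /commutator Sb.1 addr0 scalerBr opprD addrACA.
- move=> T1 T2 [T1o cT1] [T2o cT2]; split; first exact: Acomp.
  have [[T1b T1V] [T2b T2V]] := (T1o, T2o).
  have cT12 : compact_operator V (commutator T1 S \o T2).
    apply: compact_operator_compr _ _ T2b T2V cT1 => [c x Vx|].
      by rewrite -[c *: x]addr0; apply: VP.
    exact: bounded_operator_commutator.
  apply: eq_compact_operator
    (compact_operator_add (compact_operator_compl T1b cT2) cT12) => x _ /=.
  by rewrite /commutator /= (bounded_operatorB _ _ T1b) subrKA.
Qed.

End EssentialCommutation.

Lemma mact_operator_algebra (R : realType) (H : completeNormedModType R[i])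
    (m : nat) (Z : 'I_m -> {linear H -> H}) (P : (H -> H) -> Prop)
    (phi : mpoly m R[i]) :
  operator_algebra P -> (forall i, P (Z i)) -> P (mact Z phi).
Proof.
move=> [Pid P0 Pcomb Pcomp] PZ.
have Pmonom a : P (mact_monom Z a).
  rewrite /mact_monom; elim: (enum 'I_m) => //= i r IHr.
  apply: (Pcomp _ _ _ IHr).
  by elim: (a i) => //= n; apply: Pcomp.
rewrite /mact; elim: (msupp phi) => [|a r IHr].
  by move: P0; congr P; apply/funext => x; rewrite big_nil.
have := Pcomb (mcoeff a phi) _ _ (Pmonom a) IHr.
by congr P; apply/funext => x; rewrite big_cons.
Qed.

Lemma compact_operatorP (R : realType) (H : completeNormedModType R[i])
    (V : set H) (T : H -> H) :
  compact_operator V T <-> compact_on V T.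
Proof.
split; first exact: finitely_colourable_precompact.
exact: precompact_finitely_colourable.
Qed.

(** Two passes over the algebra generated by the [Z i]. The first gives the polynomial an adjoint
    [S] that commutes with every [Z i] modulo compacts; the second, with [S] fixed, replaces the
    [Z i] by the polynomial itself. *)
Lemma essentially_reductive_generators (R : realType)
    (H : completeNormedModType R[i]) (dot : {dot H for Num.conj}) (V : set H)
    (m : nat) (Z : 'I_m -> {linear H -> H}) (Zstar : 'I_m -> H -> H) :
    V 0 -> (forall (c : R[i]) x y, V x -> V y -> V (c *: x + y)) ->
    (forall i, operator_on V (Z i)) -> (forall i, operator_on V (Zstar i)) ->
    (forall i, adjoint_on dot V (Z i) (Zstar i)) ->
    (forall i j, compact_operator V (commutator (Z i) (Zstar j))) ->
  essentially_reductive dot Z V.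
Proof.
move=> V0 VP Zo Zso Zadj cZ phi.
have algV := operator_algebra_on V0 VP; have [Vid V00 Vcomb Vcomp] := algV.
have algC i := operator_algebra_commutant V0 VP (Zo i).
pose P T := operator_on V T /\ exists S,
  [/\ operator_on V S, adjoint_on dot V T S &
  forall i, essentially_commutes V (Z i) S].
have [Mo [S [So adjS ecS]]] : P (mact Z phi).
  apply: mact_operator_algebra => [|j]; last first.
    split=> //; exists (Zstar j); split=> // i.
    by apply: essentially_commutes_sym.
  split.
  - split=> //; exists id; split=> [||i] //.
    by have [] := algC i.
  - split=> //; exists (fun=> 0); split=> [||i] //; last by have [] := algC i.
    by split=> // x y _ _; rewrite linear0l linear0r.
  - move=> c T1 T2 [T1o [S1 [S1o [S1V adj1] ec1]]].
    move=> [T2o [S2 [S2o [S2V adj2] ec2]]].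
    split; first exact: Vcomb.
    exists (fun x => c^* *: S1 x + S2 x).
    split=> [||i]; [exact: Vcomb | | ]; last first.
      by have [_ _ + _] := algC i; apply.
    split=> [x Vx|x y Vx Vy]; first by apply: VP; [apply: S1V|apply: S2V].
    rewrite linearDl linearZl_LR linearDr linearZr_LR /= adj1 // adj2 //.
    by rewrite conjCK.
  - move=> T1 T2 [T1o [S1 [S1o [S1V adj1] ec1]]].
    move=> [T2o [S2 [S2o [S2V adj2] ec2]]].
    split; first exact: Vcomp.
    exists (S2 \o S1); split=> [||i]; [exact: Vcomp | | ]; last first.
      by have [_ _ _] := algC i; apply.
    split=> [x Vx|x y Vx Vy]; first exact/S2V/S1V.
    by rewrite /= adj1 ?adj2 //; [apply: S1V | case: T2o => _; apply].
exists S; split=> //.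
(* Second pass: the essential commutant of [S] contains each [Z i], hence the polynomial. *)
have Mc : essentially_commutes V S (mact Z phi).
  apply: mact_operator_algebra (operator_algebra_commutant V0 VP So) _ => i.
  exact: essentially_commutes_sym (Zo i) (ecS i).
by apply/compact_operatorP; have [] := essentially_commutes_sym So Mc.
Qed.

(** * Hilbert space geometry: adjoints, closed spans, orthogonal projections *)

Section HilbertProjections.
Variables (R : realType) (H : completeNormedModType R[i]).
Variable dot : {dot H for Num.conj}.
Hypothesis dotE : hilbert_inner_product dot.
Implicit Types (V W S : set H) (x y : H).

(** Cauchy-Schwarz, from Pythagoras applied to the component [a *: y] of [x] along [y]. *)
Lemma norm_dot_le x y : `|dot x y| <= `|x| * `|y|.
Proof.
have [->|y0] := eqVneq y 0; first by rewrite linear0r normr0 mulr_ge0.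
have yy0 : dot y y != 0 by rewrite dnorm_eq0.
pose a := dot x y / dot y y.
have orth : dot (x - a *: y) (a *: y) = 0.
  by rewrite linearZr_LR linearBl linearZl_LR /= divfK // subrr mulr0.
have le_a : `|a *: y| <= `|x|.
  rewrite -(ler_pXn2r (ltn0Sn 1)) ?nnegrE //.
  by rewrite -[x in leRHS](subrK (a *: y)) !dotE (hnormDd orth) lerDr dnorm_ge0.
have -> : `|dot x y| = `|a *: y| * `|y|.
  rewrite normrZ -mulrA -expr2 dotE normrM normfV -dotE normrX normr_id.
  by rewrite mulfVK // expf_neq0 // normr_eq0.
exact: ler_wpM2r.
Qed.

Lemma dot_nondegenerate x y : (forall z, dot z x = dot z y) -> x = y.
Proof.
move=> xy; apply/eqP; rewrite -subr_eq0 -(dnorm_eq0 dot).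
by rewrite linearBr /= xy subrr.
Qed.

(** Linearity follows from nondegeneracy. For the bound, the square of the norm of [S y] is
    [dot (T (S y)) y], and one factor cancels. *)
Lemma bounded_operator_adjoint (T S : H -> H) :
  bounded_operator T -> adjoint_on dot setT T S -> bounded_operator S.
Proof.
move=> [_ [M M0 TM]] [_ adj]; split=> [c x y|].
  apply: dot_nondegenerate => z.
  by rewrite linearDr linearZr_LR /= -!adj // linearDr linearZr_LR.
exists M => // y; have [->|Sy0] := eqVneq (S y) 0.
  by rewrite normr0 mulr_ge0 // ltW.
rewrite -(ler_pM2l (_ : 0 < `|S y|)) ?normr_gt0 //.
rewrite -expr2 dotE -adj // -[leLHS]ger0_norm ?adj ?dnorm_ge0 // -adj //.
by rewrite (le_trans (norm_dot_le _ _)) // mulrCA mulrA ler_wpM2r.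
Qed.

Definition subspace V :=
  V 0 /\ forall (c : R[i]) x y, V x -> V y -> V (c *: x + y).

Lemma closed_normP V :
  closed V <->
  forall x, (forall e : R[i], 0 < e -> exists2 y, V y & `|x - y| < e) -> V x.
Proof.
split=> [Vcl x xV|Vcl x xV].
  apply: Vcl => U /nbhs_ballP[e e0 eU].
  have [y Vy xy] := xV e e0; exists y; split=> //.
  by apply: eU; rewrite -ball_normE.
apply: Vcl => e e0; have [y [Vy]] := xV _ (nbhsx_ballx x e e0).
by rewrite -ball_normE; exists y.
Qed.

Lemma subspaceB V x y : subspace V -> V x -> V y -> V (x - y).
Proof. by move=> [_ VP] Vx Vy; rewrite addrC -scaleN1r; apply: VP. Qed.

Lemma linear_span_subspace S : subspace (linear_span S).
Proof.
split.
  by exists 0%N, (fun=> 0), (fun=> 0); split=> [[]//|]; rewrite big_ord0.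
move=> c _ _ [n [a [v [Sv ->]]]] [k [b [w [Sw ->]]]].
exists (n + k)%N.
exists (fun l =>
  match fintype.split l with inl i => c * a i | inr j => b j end).
exists (fun l => match fintype.split l with inl i => v i | inr j => w j end).
split=> [l|]; first by case: fintype.split.
rewrite big_split_ord scaler_sumr /=; congr (_ + _); apply: eq_bigr => l _.
  by rewrite (unsplitK (inl l)) scalerA.
by rewrite (unsplitK (inr l)).
Qed.

Lemma closed_span_subspace S : subspace (closed_span S).
Proof.
have [L0 LP] := linear_span_subspace S.
split; first exact: subset_closure.
move=> c x y Sx Sy U /nbhs_ballP[e e0 eU].
(* Adding 1 keeps the factor invertible when [c] is zero. *)
have c0 : 0 < `|c| + 1 by rewrite ltr_wpDl.
have e20 : 0 < (`|c| + 1)^-1 * (e / 2) by rewrite mulr_gt0 ?invr_gt0 ?divr_gt0.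
have e2 : 0 < e / 2 by rewrite divr_gt0.
have [u [Lu]] := Sx _ (nbhsx_ballx x _ e20).
have [v [Lv]] := Sy _ (nbhsx_ballx y _ e2).
rewrite -!ball_normE /= => yv xu; exists (c *: u + v); split; first exact: LP.
apply: eU; rewrite -ball_normE /= opprD addrACA -scalerBr.
rewrite (le_lt_trans (ler_normD _ _)) // [ltRHS]splitr ltrD // normrZ.
rewrite (@le_lt_trans _ _ ((`|c| + 1) * `|x - u|)) //.
  by rewrite ler_wpM2r // lerDl.
by rewrite -ltr_pdivlMl.
Qed.

Lemma sub_closed_span S : S `<=` closed_span S.
Proof.
move=> x Sx; apply: subset_closure; exists 1%N, (fun=> 1), (fun=> x).
by rewrite big_ord1 scale1r.
Qed.

Lemma closed_span_min S V :
  subspace V -> closed V -> S `<=` V -> closed_span S `<=` V.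
Proof.
move=> [V0 VP] Vcl SV; rewrite [in X in _ `<=` X](closure_id V).1 //.
apply: closureS => x [n [c [v [Sv ->]]]].
elim: n => [|n IHn] in c v Sv *; first by rewrite big_ord0.
by rewrite big_ord_recl; apply: VP; [exact/SV/Sv | apply: IHn => l; apply: Sv].
Qed.

(** The kernel of [T - T'] is a closed subspace containing [S]. *)
Lemma bounded_operator_eq_span S T T' : closed_span S = setT ->
    bounded_operator T -> bounded_operator T' ->
  (forall x, S x -> T x = T' x) -> T =1 T'.
Proof.
move=> Stot Tb T'b TT' x.
pose V := [set x | T x - T' x = 0].
suff /eqP : V x by rewrite subr_eq0 => /eqP.
have Db := bounded_operator_sub Tb T'b.
have : closed_span S x by rewrite Stot.
apply: closed_span_min => [||y Sy].
- split=> [|c y z Vy Vz]; first exact: (bounded_operator0 Db).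
  by rewrite /V /= Db.1 Vy Vz scaler0 addr0.
- apply: (preimage_closed (D := [set 0])) => [y _|].
    exact: bounded_operator_continuous Db y.
  exact/accessible_closed_set1/hausdorff_accessible/norm_hausdorff.
- by rewrite /V /= TT' // subrr.
Qed.

Lemma orthogonal_closed_span S x :
  (forall y, S y -> dot y x = 0) -> forall y, closed_span S y -> dot y x = 0.
Proof.
move=> Sx; apply: (@closed_span_min S [set y | dot y x = 0]) => //.
  split=> [|c y z /= y0 z0]; first exact: linear0l.
  by rewrite linearDl linearZl_LR /= y0 z0 mulr0 addr0.
apply/closed_normP => y yV /=; apply/eqP; rewrite -normr_le0.
apply/ler_addgt0Pr => e e0; rewrite add0r.
have x0 : 0 < `|x| + 1 by rewrite ltr_wpDl.
have [|z zx yz] := yV ((`|x| + 1)^-1 * e); first by rewrite mulr_gt0 ?invr_gt0.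
rewrite -[y](subrK z) linearDl /= zx addr0 (le_trans (norm_dot_le _ _)) //.
rewrite mulrC (@le_trans _ _ ((`|x| + 1) * `|y - z|)) //.
  by rewrite ler_wpM2r // lerDl.
by rewrite -ler_pdivlMl // ltW.
Qed.

(** By orthogonality the [V]-component is no longer than the sum, so the [V]-components of sums
    approaching [x] form a Cauchy filter; its limit is the component sought. *)
Lemma orthogonal_sum_closed V W : subspace V -> subspace W ->
    closed V -> closed W -> (forall v w, V v -> W w -> dot v w = 0) ->
  closed [set x | exists2 v, V v & W (x - v)].
Proof.
move=> sV sW Vcl Wcl VW; apply/closed_normP => x xVW.
have norm_le v w : V v -> W w -> `|v| <= `|v + w|.
  move=> Vv Ww; rewrite -(ler_pXn2r (ltn0Sn 1)) ?nnegrE //.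
  by rewrite !dotE (hnormDd (VW _ _ Vv Ww)) lerDl dnorm_ge0.
pose near_x e : set H := [set v | V v /\ exists2 w, W w & `|x - (v + w)| < e].
pose F := filter_from [set e : R[i] | 0 < e] near_x.
have near_xF e : 0 < e -> F (near_x e) by move=> e0; exists e.
have FF : ProperFilter F.
  apply: filter_from_proper => [|e e0].
    apply: filter_from_filter => [|d e d0 e0]; first by exists 1; apply: ltr01.
    (* The order on [R[i]] is partial; positive elements are real, hence comparable, and have a
       minimum. *)
    have de_real : d \is Num.real /\ e \is Num.real by rewrite !gtr0_real.
    have [dr er] := de_real; have cde := real_comparable dr er.
    exists (Order.min d e); first by rewrite /= comparable_lt_min // d0.
    move=> v [Vv [w Ww]]; rewrite comparable_lt_min // => /andP[? ?].
    by split; split=> //; exists w.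
  have [y [v Vv Wyv] xy] := xVW e e0.
  by exists v; split=> //; exists (y - v); rewrite // subrKC.
have /cauchy_cvg Fc : cauchy F.
  apply: cauchy_exP => e e0; have e20 : 0 < e / 2 by rewrite divr_gt0.
  have [v [Vv [w Ww vw]]] := filter_ex (near_xF _ e20).
  exists v; apply: filterS (near_xF _ e20) => u [Vu [z Wz uz]].
  rewrite -ball_normE /=.
  apply: le_lt_trans
    (norm_le _ (w - z) (subspaceB sV Vv Vu) (subspaceB sW Ww Wz)) _.
  rewrite addrACA -opprD -(subrKA x) [ltRHS]splitr.
  by rewrite (le_lt_trans (ler_normD _ _)) // ltrD // distrC.
exists (lim F).
  apply: (@closed_cvg _ _ F _ id V Vcl _ _ Fc).
  by apply: filterS (near_xF 1 ltr01) => v [].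
apply: ((closed_normP W).1 Wcl) => e e0.
have e20 : 0 < e / 2 by rewrite divr_gt0.
have := Fc _ (nbhsx_ballx (lim F) _ e20); rewrite -ball_normE.
move=> /(filterI (near_xF _ e20))/filter_ex[v [[Vv [w Ww xvw]] vlim]].
exists w => //; rewrite -addrA -opprD -(subrKA (v + w)) [ltRHS]splitr.
rewrite (le_lt_trans (ler_normD _ _)) // ltrD //.
by rewrite opprD addrACA subrr addr0 distrC.
Qed.

Definition orthogonal_projection V (P : H -> H) :=
  forall x, V (P x) /\ forall y, V y -> dot (x - P x) y = 0.

Lemma orthogonal_projection_unique V P x u : subspace V ->
  orthogonal_projection V P -> V u -> (forall y, V y -> dot (x - u) y = 0) ->
  P x = u.
Proof.
move=> sV /(_ x)[VPx Px] Vu xu.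
apply/eqP; rewrite -subr_eq0 -(dnorm_eq0 dot).
have Vd := subspaceB sV VPx Vu.
rewrite -[X in dot X _](subrKA x) addrC linearDl /= xu // -opprB linearNl /=.
by rewrite Px // oppr0 addr0.
Qed.

Section Projection.
Variables (V : set H) (P : H -> H).
Hypotheses (sV : subspace V) (VP : orthogonal_projection V P).

Lemma orthogonal_projection_fix x : V x -> P x = x.
Proof.
move=> Vx; apply: orthogonal_projection_unique sV VP Vx _ => y _.
by rewrite subrr linear0l.
Qed.

Lemma orthogonal_projection_kernel x :
  (forall y, V y -> dot y x = 0) -> P x = 0.
Proof.
move=> xV; apply: orthogonal_projection_unique sV VP sV.1 _ => y Vy.
by rewrite subr0; apply/eqP; rewrite herm_eq0C; apply/eqP/xV.
Qed.

Lemma orthogonal_projection_selfadjoint x y : dot (P x) y = dot x (P y).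
Proof.
have [[VPx xP] [VPy yP]] := (VP x, VP y).
rewrite -[y in LHS](subrK (P y)) -[x in RHS](subrK (P x)).
rewrite linearDr linearDl /= xP // add0r.
have /eqP -> : dot (P x) (y - P y) == 0 by rewrite herm_eq0C; apply/eqP/yP.
by rewrite add0r.
Qed.

Lemma orthogonal_projection_bounded : bounded_operator P.
Proof.
split=> [c x y|].
  have [[VPx xP] [VPy yP]] := (VP x, VP y).
  apply: orthogonal_projection_unique sV VP (sV.2 _ _ _ _ _) _ => // z Vz.
  rewrite opprD addrACA -scalerBr linearDl linearZl_LR /= xP // yP //.
  by rewrite mulr0 addr0.
exists 1 => // x; have [VPx xP] := VP x; rewrite mul1r.
rewrite -(ler_pXn2r (ltn0Sn 1)) ?nnegrE //.
rewrite -[x in leRHS](subrK (P x)) !dotE (hnormDd (xP _ VPx)).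
by rewrite lerDr dnorm_ge0.
Qed.

End Projection.
End HilbertProjections.

(** * Shifts along an orthogonal total family of monomials *)

Section MonomialShifts.
Variables (R : realType) (H : completeNormedModType R[i]).
Variable dot : {dot H for Num.conj}.
Hypothesis dotE : hilbert_inner_product dot.
Variables (m : nat) (e : multinom m -> H).
Hypothesis e_orth : forall a b, a <> b -> dot (e a) (e b) = 0.
Hypothesis e_total : closed_span (range e) = setT.
Implicit Types (a b : multinom m) (B : set (multinom m)).

Local Notation span B := (closed_span (e @` B)).

Lemma eq_on_monomials T S : bounded_operator T -> bounded_operator S ->
  (forall a, T (e a) = S (e a)) -> T =1 S.
Proof.
move=> Tb Sb TS.
by apply: bounded_operator_eq_span e_total Tb Sb _ => _ [a _ <-].
Qed.

Lemma span_orthogonal B C v w : B `&` C = set0 ->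
  span B v -> span C w -> dot v w = 0.
Proof.
move=> BC Bv Cw.
apply: (orthogonal_closed_span dotE _ Bv) => _ [a Ba <-].
apply/eqP; rewrite herm_eq0C; apply/eqP.
apply: (orthogonal_closed_span dotE _ Cw) => _ [b Cb <-].
by apply: e_orth => ba; have : (B `&` C) b by [rewrite ba in Cb *]; rewrite BC.
Qed.

(** The spans of [B] and of its complement are orthogonal, so their sum is closed; it contains every
    monomial and is therefore all of [H]. *)
Lemma span_projection B : exists P,
  [/\ orthogonal_projection dot (span B) P, bounded_operator P,
      forall a, B a -> P (e a) = e a & forall a, ~ B a -> P (e a) = 0].
Proof.
have sS C := closed_span_subspace (e @` C).
have clS C : closed (span C) by apply: closed_closure.
have orth v w : span B v -> span (~` B) w -> dot v w = 0.
  by apply: span_orthogonal; rewrite setICr.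
have decomp x : exists v, span B v /\ span (~` B) (x - v).
  suff: closed_span (range e) x.
    suff /[apply] [[v Bv Cv]] : closed_span (range e) `<=`
        [set x | exists2 v, span B v & span (~` B) (x - v)] by exists v.
    apply: closed_span_min; last first.
    - move=> _ [a _ <-]; have [Ba|nBa] := pselect (B a).
        exists (e a); first by apply: sub_closed_span; exists a.
        by rewrite subrr; have [] := sS (~` B).
      exists 0; first by have [] := sS B.
      by rewrite subr0; apply: sub_closed_span; exists a.
    - exact: orthogonal_sum_closed.
    split=> [|c x1 x2 [v1 Bv1 Cw1] [v2 Bv2 Cw2]].
      by exists 0; rewrite ?subr0; [have [] := sS B | have [] := sS (~` B)].
    exists (c *: v1 + v2); first exact: (sS B).2.
    by rewrite opprD addrACA -scalerBr; apply: (sS _).2.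
  by rewrite e_total.
have [P PP] := choice decomp; exists P.
have projP : orthogonal_projection dot (span B) P.
  move=> x; have [BPx CPx] := PP x; split=> // y By.
  by apply/eqP; rewrite herm_eq0C; apply/eqP/orth.
split=> //; first exact: orthogonal_projection_bounded (sS B) projP.
  move=> a Ba; apply: (orthogonal_projection_fix (sS B) projP).
  by apply: sub_closed_span; exists a.
move=> a nBa; apply: (orthogonal_projection_kernel (sS B) projP) => y By.
by apply: orth By _; apply: sub_closed_span; exists a.
Qed.

Section Shift.
Variables (i : 'I_m) (T Tstar : H -> H).
Hypotheses (Tb : bounded_operator T) (Te : forall a, T (e a) = e (mshift a i)).
Hypotheses (Tadj : adjoint_on dot setT T Tstar)
  (cT : compact_operator setT (commutator T Tstar)).

Lemma compact_shift_slab n : exists Q : H -> H,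
  [/\ bounded_operator Q, forall a, (a i < n)%N -> Q (e a) = e a,
      forall a, ~ (a i < n)%N -> Q (e a) = 0 & compact_operator setT (T \o Q)].
Proof.
have [Q QP] :=
  choice (fun n => span_projection [set a : multinom m | (a i < n)%N]).
have Tsb : bounded_operator Tstar := bounded_operator_adjoint dotE Tb Tadj.
have Qb k : bounded_operator (Q k) by have [] := QP k.
exists (Q n); have [_ _ Qid Q0] := QP n; split=> //.
elim: n {Qid Q0} => [|n IHn].
  apply: eq_compact_operator (compact_operator_cst0 _) => x _.
  apply: (eq_on_monomials (bounded_operator_comp Tb (Qb _))
    (bounded_operator_cst0 _)) => a.
  by have [_ _ _ Q0] := QP 0%N; rewrite /= Q0 ?(bounded_operator0 Tb).
(* [T] raises the [i]-th exponent by exactly one, so it carries each slab into the next. Taking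
   adjoints gives the relation for [Tstar] below. *)
have QT x : Q n.+1 (T x) = T (Q n x).
  apply: (eq_on_monomials (bounded_operator_comp (Qb _) Tb)
    (bounded_operator_comp Tb (Qb _))) => a /=.
  have [_ _ Qid Q0] := QP n; have [_ _ Qid1 Q01] := QP n.+1.
  have sai : mshift a i i = (a i).+1 by rewrite mnmDE mnm1E eqxx addn1.
  have [an|an] := ltnP (a i) n; first by rewrite Qid // Te Qid1 //= sai.
  have nan : ~ (a i < n)%N by apply/negP; rewrite -leqNgt.
  by rewrite Q0 // (bounded_operator0 Tb) Te Q01 //= sai.
have TstarQ x : Tstar (Q n.+1 x) = Q n (Tstar x).
  apply: (@dot_nondegenerate _ _ dot) => z.
  have [p0 _ _ _] := QP n; have [p1 _ _ _] := QP n.+1.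
  rewrite -Tadj.2 // -(orthogonal_projection_selfadjoint p1) QT.
  by rewrite Tadj.2 // (orthogonal_projection_selfadjoint p0).
have Sb := bounded_operator_comp Tsb (bounded_operator_comp Tb (Qb n.+1)).
have [_ [M M0 QM]] := Qb n.+1.
have TQb := bounded_operator_comp Tb (Qb n.+1).
(* The squared norm of [T (Q x)] is the inner product of [Q x] with [Tstar (T (Q x))], where [Q] is
   [Q n.+1] with bound [M]. *)
apply: (compact_operator_sqr_le M0 TQb Sb) => [x|].
  rewrite -[leLHS]ger0_norm ?exprn_ge0 // dotE Tadj.2 //.
  by rewrite (le_trans (norm_dot_le dotE _ _)) // mulrAC ler_wpM2r.
have c1 : compact_operator setT ((T \o Q n) \o Tstar).
  apply: compact_operator_compr IHn => //.
  exact: bounded_operator_comp.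
have c2 : compact_operator setT (commutator T Tstar \o Q n.+1).
  by apply: compact_operator_compr cT => //; apply: bounded_operator_commutator.
apply: eq_compact_operator (compact_operator_sub c1 c2) => x _.
by rewrite /= /commutator TstarQ opprB subrKC.
Qed.

(** The corner of [T] from the complement of [B] into [B] factors through a slab: by
    [shift_entry_bound], a monomial outside [B] with [i]-th exponent at least [n] is shifted to one
    outside [B], which [P] kills. *)
Lemma compact_hankel_shift B P : shift_invariant B -> bounded_operator P ->
    (forall a, B a -> P (e a) = e a) -> (forall a, ~ B a -> P (e a) = 0) ->
  compact_operator setT (fun x => P (T (x - P x))).
Proof.
move=> Bshift Pb Pid P0; have [n nB] := shift_entry_bound Bshift i.
have [Q [Qb Qid Q0 cTQ]] := compact_shift_slab n.
have PCb := bounded_operator_sub (bounded_operator_id H) Pb.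
have cPTQ : compact_operator setT ((P \o (T \o Q)) \o (fun x => x - P x)).
  apply: compact_operator_compr _ _ PCb _ (compact_operator_compl Pb cTQ) => //.
  exact: bounded_operator_comp Pb (bounded_operator_comp Tb Qb).
apply: eq_compact_operator cPTQ => x _.
have PTPCb := bounded_operator_comp (bounded_operator_comp Pb Tb) PCb.
have PTQPCb := bounded_operator_comp
  (bounded_operator_comp Pb (bounded_operator_comp Tb Qb)) PCb.
apply: (eq_on_monomials PTPCb PTQPCb) => a /=.
have [Ba|nBa] := pselect (B a).
  by rewrite Pid // subrr (bounded_operator0 Qb).
rewrite P0 // subr0; have [an|an] := pselect (a i < n)%N; first by rewrite Qid.
rewrite Q0 // Te (bounded_operator0 Tb) (bounded_operator0 Pb) P0 //.
by move=> Ba; apply/an/nB.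
Qed.

End Shift.
End MonomialShifts.

(** * Compression to the submodule of a shift invariant set *)

Theorem theorem6 (R : realType) (m : nat) (m_ge1 : (1 <= m)%N)
    (lam : multinom m -> R) (lam_weight : weight_set lam)
    (H : completeNormedModType R[i]) (dot : {dot H for Num.conj})
    (emb : {linear mpoly m R[i] -> H})
    (H_completion : weighted_completion dot lam emb)
    (Z : 'I_m -> {linear H -> H})
    (Z_mult : coordinate_multipliers emb Z)
    (lam_star : cond_star lam)
    (lam_starstar : cond_starstar dot Z)
    (B : set (multinom m)) (B_shift : shift_invariant B) :
  submodule Z (monomial_submodule emb B) /\
  essentially_reductive dot Z (monomial_submodule emb B).
Proof.
have [dotE emb_orth _ emb_total] := H_completion.
pose e a := emb (mpolyX _ a).
have Ze i a : Z i (e a) = e (mshift a i).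
  by have [_ ->] := Z_mult i; rewrite /e /mshift addmC mpolyXD.
have Zb i : bounded_operator (Z i).
  by apply: bounded_operator_linear; have [] := Z_mult i.
(* The hypothesis gives an adjoint of [Z j] for each pair of indices. One is fixed per [j] from the
   diagonal pairs, and uniqueness of adjoints transfers compactness to all pairs. *)
have [Zs ZsP] := choice (fun j => lam_starstar j j).
have Zadj j : adjoint_on dot setT (Z j) (Zs j) by have [] := ZsP j.
have Zsb j : bounded_operator (Zs j).
  exact: (bounded_operator_adjoint dotE (Zb j) (Zadj j)).
have cZZs i j : compact_operator setT (commutator (Z i) (Zs j)).
  have [S [Sadj /compact_operatorP]] := lam_starstar i j.
  suff -> : S = Zs j by [].
  apply/funext => y; apply: (@dot_nondegenerate _ _ dot) => z.
  by rewrite -Sadj.2 // (Zadj j).2.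
have [P [projP Pb Pid P0]] := span_projection dotE emb_orth emb_total B.
have sV : subspace (monomial_submodule emb B) := closed_span_subspace _.
have PV := orthogonal_projection_fix sV projP.
have VP x : monomial_submodule emb B (P x) by have [] := projP x.
(* Invariance of the submodule as an operator identity, which by boundedness need only be checked on
   monomials. *)
have ZP i x : P (Z i (P x)) = Z i (P x).
  have ZPb := bounded_operator_comp (Zb i) Pb.
  apply: (eq_on_monomials emb_total (bounded_operator_comp Pb ZPb) ZPb) => a /=.
  have [Ba|nBa] := pselect (B a).
    by rewrite Pid // Ze Pid //; apply: B_shift.
  by rewrite P0 // linear0 (bounded_operator0 Pb).
have ZV i x : monomial_submodule emb B x -> monomial_submodule emb B (Z i x).
  by move=> Vx; rewrite -(PV x Vx) -ZP.
have [V0 VD] := sV.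
split; first by split=> //; apply: closed_closure.
have PZsb j := bounded_operator_comp Pb (Zsb j).
apply: (essentially_reductive_generators (Zstar := fun j => P \o Zs j)) => //.
- by move=> i; split=> // x; apply: ZV.
- by move=> j; split=> // x _; apply: VP.
- move=> j; split=> [x _|x y Vx Vy]; first exact: VP.
  rewrite (Zadj j).2 // -[in LHS](PV x Vx).
  exact: (orthogonal_projection_selfadjoint projP).
- move=> i j.
  have cPZ := compact_hankel_shift dotE emb_orth emb_total (Zb i) (Ze i)
    (Zadj i) (cZZs i i) B_shift Pb Pid P0.
  have cPZZs : compact_operator setT
      ((fun x => P (Z i (x - P x))) \o Zs j).
    apply: compact_operator_compr cPZ => //.
    exact: bounded_operator_comp (bounded_operator_comp Pb (Zb i))
      (bounded_operator_sub (bounded_operator_id H) Pb).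
  have cV := sub_compact_operator (@subsetT _ (monomial_submodule emb B))
    (compact_operator_sub (compact_operator_compl Pb (cZZs i j)) cPZZs).
  (* The two terms [P (Z i (Zs j x))] cancel, and [ZP] removes the outer [P] from the remaining
     one. *)
  apply: eq_compact_operator cV => x Vx.
  rewrite /commutator /= !linearB /= !(bounded_operatorB _ _ Pb) ZP.
  by rewrite opprB [RHS]addrC subrKA.
Qed.
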